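(* Let $\lambda\ge1$ and $s\ge0$ be integers, and let $z\in\mathbb{C}$ with $|z|<1$ and $z\ne\bar z$. Let $$\Sigma_s^{(\lambda)}(z,\bar z)=\sum_{n=0}^\infty C_n^{(\lambda)}\!\left(\frac{z+\bar z}{2\sqrt{z\bar z}}\right)(z\bar z)^{n/2}\,\frac{1}{(\lambda+n)^s}.$$ Then $$\Sigma_s^{(\lambda)}(z,\bar z)=\sum_{k=0}^{\lambda-1}\frac{G_k^{(\lambda)}(z,\bar z)}{(z-\bar z)^{2\lambda-1-k}}\operatorname{Li}_{s-k}(z)+(z\leftrightarrow\bar z),$$ where $$G_k^{(\lambda)}(z,\bar z)=\frac{(z-\bar z)^{2\lambda-1-k}}{(\lambda-1)!}\,\frac{1}{k!}\,\partial_t^{\lambda-1}\,\frac{(1+t)^{\lambda-1}\log^k(1+t)}{\left((1+t)z-\bar z\right)^\lambda}\Bigg|_{t=0}.$$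
   Context: $\bar z$ is the complex conjugate of $z$. $C_n^{(\lambda)}$ are the Gegenbauer polynomials, $\sum_{n\ge0}C_n^{(\lambda)}(r)t^n=(1-2rt+t^2)^{-\lambda}$. $\operatorname{Li}_m(z)=\sum_{n\ge1}z^n/n^m$ for every integer $m$ (also $m\le0$), $|z|<1$. The notation ''$+(z\leftrightarrow\bar z)$'' means adding the same expression with $z$ and $\bar z$ interchanged. *)

(* Defs.v *)
From Stdlib Require Import Reals ZArith Lra Lia.
From Coquelicot Require Import Coquelicot.

Open Scope R_scope.

(* Series of complex numbers and derivatives of functions R -> C are taken in
   C as a normed space over R.  Like [RInt], both operators are total: the value
   is unspecified when the limit does not exist. *)
Definition C_ex_series (a : nat -> C) : Prop :=
  ex_series (V := C_R_NormedModule) a.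

Definition C_Series (a : nat -> C) : C :=
  iota (T := C_R_CompleteNormedModule) (is_series (V := C_R_NormedModule) a).

Definition C_Derive (f : R -> C) (x : R) : C :=
  iota (T := C_R_CompleteNormedModule) (is_derive (V := C_R_NormedModule) f x).

Fixpoint C_Derive_n (f : R -> C) (n : nat) (x : R) : C :=
  match n with
  | O => f x
  | S m => C_Derive (C_Derive_n f m) x
  end.

(* Coefficient of t^n in the expansion of (1 - 2 r t + t^2)^(-lam) at t = 0;
   the generating function identity is [gegenbauer_generating] below. *)
Definition gegenbauer (lam n : nat) (r : R) : R :=
  Derive_n (fun t : R => / (1 - 2 * r * t + t ^ 2) ^ lam) n 0 / INR (fact n).

(* The sum over n >= 1 is reindexed to start at 0. *)
Definition Li (m : Z) (z : C) : C :=
  C_Series (fun n => (Cpow z (S n) / RtoC (powerRZ (INR (S n)) m))%C).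

(* z + Cconj z and z * Cconj z are real, so [Re] only changes their type. *)
Definition Sigma_term (lam s : nat) (z : C) (n : nat) : C :=
  RtoC (gegenbauer lam n
          (Re (z + Cconj z)%C / (2 * sqrt (Re (z * Cconj z)%C)))
        * Rpower (Re (z * Cconj z)%C) (INR n / 2)
        * (1 / INR (lam + n) ^ s)).

Definition Sigma (lam s : nat) (z : C) : C := C_Series (Sigma_term lam s z).

(* [w] stands for the conjugate of [z], so that z and its conjugate can be
   interchanged. The parameter t is real, hence the logarithm is the real one;
   for k <= lam - 1 the exponent 2 lam - 1 - k is not truncated. *)
Definition G (lam k : nat) (z w : C) : C :=
  ((z - w) ^ (2 * lam - 1 - k) / RtoC (INR (fact (lam - 1)))
   * (1 / RtoC (INR (fact k)))
   * C_Derive_n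
       (fun t : R =>
          (RtoC ((1 + t) ^ (lam - 1) * ln (1 + t) ^ k)
           / (RtoC (1 + t) * z - w) ^ lam)%C)
       (lam - 1) 0)%C.

Definition Li_sum (lam s : nat) (z w : C) : C :=
  sum_n (G := C_AbelianMonoid)
    (fun k => (G lam k z w / (z - w) ^ (2 * lam - 1 - k)
               * Li (Z.of_nat s - Z.of_nat k) z)%C)
    (lam - 1).

Lemma C_Series_unique (a : nat -> C) (l : C) :
  is_series (V := C_R_NormedModule) a l -> C_Series a = l.
Proof.
intros H.
apply (iota_filterlim_locally (V := C_R_CompleteNormedModule)
         (F := eventually) _ l H).
Qed.

Lemma C_Derive_unique (f : R -> C) (x : R) (l : C) :
  is_derive (V := C_R_NormedModule) f x l -> C_Derive f x = l.
Proof.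
intros H.
apply (iota_unique (V := C_R_CompleteNormedModule)); [|exact H].
intros y Hy.
pose proof (filterdiff_ext_lin _ _ _ Hy (fun _ => eq_refl)) as Hy'.
assert (D1 : is_derive (fun t => Re (f t)) x (Re y)).
{ apply (filterdiff_ext_lin _ (fun h : R => Re (scal (V := C_R_ModuleSpace) h y))).
  2: intros h; reflexivity.
  apply (filterdiff_comp' f (fun c : C_R_NormedModule => Re c)); [exact Hy|].
  apply filterdiff_linear, is_linear_fst. }
assert (D2 : is_derive (fun t => Re (f t)) x (Re l)).
{ apply (filterdiff_ext_lin _ (fun h : R => Re (scal (V := C_R_ModuleSpace) h l))).
  2: intros h; reflexivity.
  apply (filterdiff_comp' f (fun c : C_R_NormedModule => Re c)); [exact H|].
  apply filterdiff_linear, is_linear_fst. }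
assert (D3 : is_derive (fun t => Im (f t)) x (Im y)).
{ apply (filterdiff_ext_lin _ (fun h : R => Im (scal (V := C_R_ModuleSpace) h y))).
  2: intros h; reflexivity.
  apply (filterdiff_comp' f (fun c : C_R_NormedModule => Im c)); [exact Hy|].
  apply filterdiff_linear, is_linear_snd. }
assert (D4 : is_derive (fun t => Im (f t)) x (Im l)).
{ apply (filterdiff_ext_lin _ (fun h : R => Im (scal (V := C_R_ModuleSpace) h l))).
  2: intros h; reflexivity.
  apply (filterdiff_comp' f (fun c : C_R_NormedModule => Im c)); [exact H|].
  apply filterdiff_linear, is_linear_snd. }
apply is_derive_unique in D1, D2, D3, D4.
destruct y as [y1 y2], l as [l1 l2]; simpl in *; congruence.
Qed.

(* Consecutive coefficients of 1 / (1 - 2 r t + t^2). *)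
Fixpoint gseq (r : R) (n : nat) : R * R :=
  match n with
  | O => (1, 2 * r)
  | S m => let (a, b) := gseq r m in (b, 2 * r * b - a)
  end.

Lemma gseq_bound (r : R) (n : nat) :
  Rabs (fst (gseq r n)) <= (2 * Rabs r + 1) ^ n /\
  Rabs (snd (gseq r n)) <= (2 * Rabs r + 1) ^ S n.
Proof.
pose proof (Rabs_pos r) as Hr.
induction n as [|n [IH1 IH2]].
- simpl. rewrite Rabs_R1, Rabs_mult, (Rabs_pos_eq 2) by lra. lra.
- simpl gseq. destruct (gseq r n) as [a b]. simpl fst in *. simpl snd in *.
  split; [exact IH2|].
  eapply Rle_trans; [apply Rabs_triang|].
  rewrite Rabs_Ropp, !Rabs_mult, (Rabs_pos_eq 2) by lra.
  set (M := 2 * Rabs r + 1) in *.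
  assert (HP : 0 <= M ^ n) by (apply pow_le; unfold M; lra).
  simpl pow in *.
  apply Rle_trans with ((M - 1) * (M * M ^ n) + M ^ n).
  + unfold M at 1. replace (2 * Rabs r + 1 - 1) with (2 * Rabs r) by ring.
    apply Rplus_le_compat; [|exact IH1].
    apply Rmult_le_compat_l; [lra | exact IH2].
  + assert (M >= 1) by (unfold M; lra). nra.
Qed.

Lemma CV_radius_pos (a : nat -> R) (x : R) :
  0 < x -> ex_pseries a x -> Rbar_lt 0 (CV_radius a).
Proof.
intros Hx Ha.
destruct (Rbar_lt_le_dec (CV_radius a) (Finite (Rabs x))) as [H|H].
- exfalso. apply (CV_disk_outside _ _ H).
  destruct Ha as [l Ha]. apply is_pseries_R in Ha.
  apply (ex_series_lim_0 (fun n => a n * x ^ n)). exists l. exact Ha.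
- eapply Rbar_lt_le_trans; [|exact H]. simpl. now rewrite Rabs_pos_eq; lra.
Qed.

Lemma CV_radius_locally (a : nat -> R) :
  Rbar_lt 0 (CV_radius a) ->
  locally 0 (fun t => Rbar_lt (Rabs t) (CV_radius a)).
Proof.
destruct (CV_radius a) as [c| |]; intros H; try easy.
- exists (mkposreal c H). intros t Ht.
  change (Rabs (t + - 0) < c) in Ht. now rewrite Ropp_0, Rplus_0_r in Ht.
- now exists (mkposreal 1 Rlt_0_1).
Qed.

Lemma gseq_generating (r : R) :
  exists a, Rbar_lt 0 (CV_radius a) /\
    locally 0 (fun t => PSeries a t = / (1 - 2 * r * t + t ^ 2)).
Proof.
set (b := fun n => fst (gseq r n)).
set (M := 2 * Rabs r + 1).
assert (HM : 1 <= M) by (unfold M; pose proof (Rabs_pos r); lra).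
assert (Hrec : forall n, b (S (S n)) = 2 * r * b (S n) - b n).
{ intros n. unfold b. simpl. now destruct (gseq r n). }
assert (Hcv : Rbar_lt 0 (CV_radius b)).
{ apply Rbar_lt_le_trans with (Finite (/ M)).
  - simpl. apply Rinv_0_lt_compat. lra.
  - apply (CV_radius_bounded b). exists 1. intros n.
    rewrite Rabs_mult, <- RPow_abs, Rabs_inv, (Rabs_pos_eq M) by lra.
    rewrite pow_inv.
    assert (0 < M ^ n) by (apply pow_lt; lra).
    apply Rle_trans with (M ^ n * / M ^ n).
    + apply Rmult_le_compat_r; [left; now apply Rinv_0_lt_compat|].
      apply gseq_bound.
    + right. field. lra. }
exists b. split; [exact Hcv|].
generalize (CV_radius_locally b Hcv). apply filter_imp.
enough (HB : forall t : R, Rbar_lt (Rabs t) (CV_radius b) ->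
          PSeries b t = / (1 - 2 * r * t + t ^ 2)) by exact HB.
intros t Ht.
assert (Ex0 : ex_pseries b t) by now apply CV_radius_inside.
assert (Ex1 : ex_pseries (PS_decr_1 b) t)
  by (apply CV_radius_inside; now rewrite CV_radius_decr_1).
assert (E0 := PSeries_decr_1 b t Ex0).
assert (E1 := PSeries_decr_1 _ t Ex1).
assert (E2 : PSeries (PS_decr_1 (PS_decr_1 b)) t
             = 2 * r * PSeries (PS_decr_1 b) t - PSeries b t).
{ rewrite <- PSeries_scal, <- PSeries_minus;
    [|apply ex_pseries_scal; [apply Rmult_comm | exact Ex1]|exact Ex0].
  apply PSeries_ext. intros n. exact (Hrec n). }
change (PS_decr_1 b 0%nat) with (2 * r) in E1.
change (b 0%nat) with 1 in E0.
assert (E : PSeries b t * (1 - 2 * r * t + t ^ 2) = 1).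
{ rewrite E2 in E1.
  set (B := PSeries b t) in *. set (D := PSeries (PS_decr_1 b) t) in *.
  assert (t * D = B - 1) by lra.
  replace B with (1 + t * D) at 1 by lra.
  assert (E3 : t * D = t * (2 * r) + t * (2 * r * (t * D)) - t * t * B)
    by (rewrite E1 at 1; ring).
  rewrite H in *. clear - E3. simpl. nra. }
apply Rmult_eq_reg_r with (1 - 2 * r * t + t ^ 2).
- rewrite E, Rinv_l; [easy|]. intros H. rewrite H in E. lra.
- intros H. rewrite H in E. lra.
Qed.

Lemma gegenbauer_expansion (lam : nat) (r : R) :
  exists a, Rbar_lt 0 (CV_radius a) /\
    locally 0 (fun t => is_pseries a t (/ (1 - 2 * r * t + t ^ 2) ^ lam)).
Proof.
induction lam as [|lam [a [Ha1 Ha2]]].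
- exists (fun n => match n with O => 1 | S _ => 0 end).
  assert (H : forall t, is_pseries
            (fun n => match n with O => 1 | S _ => 0 end) t 1).
  { intros t. apply is_pseries_R.
    apply (is_series_decr_1 (fun n => match n with O => 1 | S _ => 0 end * t ^ n)).
    simpl. unfold plus, opp; simpl. rewrite Rmult_1_r, Rplus_opp_r.
    apply (is_series_ext (fun _ => 0)).
    { intros n. change (0 = 0 * t ^ S n). ring. }
    apply (filterlim_ext (fun _ => 0)); [|apply filterlim_const].
    intros n. rewrite sum_n_const. ring. }
  split.
  + apply CV_radius_pos with 1; [lra|]. exists 1. apply H.
  + apply filter_forall. intros t. simpl. rewrite Rinv_1. apply H.
- destruct (gseq_generating r) as [b [Hb1 Hb2]].
  exists (PS_mult b a).
  assert (HL : locally 0 (fun t => is_pseries (PS_mult b a) t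
                           (/ (1 - 2 * r * t + t ^ 2) ^ S lam))).
  { generalize (filter_and _ _ (filter_and _ _ (CV_radius_locally _ Ha1) (CV_radius_locally _ Hb1))
                               (filter_and _ _ Ha2 Hb2)).
    apply filter_imp. intros t [[Ta Tb] [Ea Eb]].
    simpl pow at 2. simpl pow in Ea. rewrite <- tech_pow_Rmult, Rinv_mult.
    apply is_pseries_mult; try easy.
    simpl pow in Eb. rewrite <- Eb. apply PSeries_correct.
    now apply CV_radius_inside. }
  split; [|exact HL].
  destruct HL as [e He].
  apply CV_radius_pos with (e / 2).
  + destruct e as [e Pe]; simpl; lra.
  + eexists. apply He.
    unfold ball; simpl; unfold AbsRing_ball; simpl.
    unfold abs, minus, plus, opp; simpl. destruct e as [e Pe]; simpl.
    rewrite Rabs_pos_eq; lra.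
Qed.

Lemma gegenbauer_generating (lam : nat) (r : R) :
  locally 0 (fun t => is_pseries (fun n => gegenbauer lam n r) t
                        (/ (1 - 2 * r * t + t ^ 2) ^ lam)).
Proof.
destruct (gegenbauer_expansion lam r) as [a [Ha1 Ha2]].
generalize Ha2. apply filter_imp. intros t.
apply is_pseries_ext. intros n. unfold gegenbauer.
rewrite (Derive_n_ext_loc _ (PSeries a)).
- rewrite Derive_n_coef by exact Ha1.
  change (a n = a n * INR (fact n) / INR (fact n)).
  field. apply INR_fact_neq_0.
- revert Ha2. apply filter_imp. intros u Hu. symmetry.
  now apply is_pseries_unique.
Qed.

(* Main.v *)
Require Import Defs.
From Stdlib Require Import Reals ZArith Lra Lia.
From Coquelicot Require Import Coquelicot.

(* Write w for the conjugate of z. The n-th term of Sigma has numerator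
   [t^n] ((1 - z t)(1 - w t))^(-lam), which for m = n + lam is the sum of the
   residues of u^(m + lam - 1) / ((u - z)^lam (u - w)^lam) at u = z and u = w.
   Substituting u = z (1 + t), the first residue is
   z^m [t^(lam - 1)] (1 + t)^(m + lam - 1) / ((1 + t) z - w)^lam, and expanding
   (1 + t)^m = exp (m ln (1 + t)) makes it a polynomial in m whose coefficients
   are those of the polylogarithms in [Li_sum]. The residue sum vanishes for
   1 <= m < lam, so that the polylogarithms may start at m = 1.
   No residue calculus is needed: the sum of residues and the Gegenbauer
   coefficients satisfy the same linear recurrence. *)

Open Scope C_scope.

(* Equalities between Coquelicot vectors are typed by the carrier of an
   algebraic structure, where [ring] and [field] do not recognize R or C. *)
Ltac R_eq := match goal with |- @eq _ ?x ?y => change (@eq R x y) end.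

Ltac C_eq := change plus with Cplus;
  match goal with |- @eq _ ?x ?y => change (@eq C x y) end.

(** * Casts of naturals and factorials into C *)

Lemma RtoC_INR_S (n : nat) : RtoC (INR (S n)) = RtoC (INR n) + 1.
Proof. now rewrite S_INR, RtoC_plus. Qed.

Lemma RtoC_INR_neq_0 (n : nat) : n <> 0%nat -> RtoC (INR n) <> 0.
Proof. intros Hn E. apply RtoC_inj in E. now apply not_0_INR in E. Qed.

Lemma RtoC_fact_neq_0 (n : nat) : RtoC (INR (fact n)) <> 0.
Proof. apply RtoC_INR_neq_0, fact_neq_0. Qed.

Lemma RtoC_fact_S (n : nat) :
  RtoC (INR (fact (S n))) = (RtoC (INR n) + 1) * RtoC (INR (fact n)).
Proof. now rewrite fact_simpl, mult_INR, RtoC_mult, RtoC_INR_S. Qed.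

(** * Formal derivatives and their values at [t = 0] *)

(* The [n]-th derivative of
   [(1 + t) ^ a * ln (1 + t) ^ k / ((1 + t) z - w) ^ b], correct only for
   [n <= a] because [pred] truncates the exponent. *)
Fixpoint jet (z w : C) (n a k b : nat) (t : R) : C :=
  match n with
  | O => RtoC ((1 + t) ^ a * ln (1 + t) ^ k) / (RtoC (1 + t) * z - w) ^ b
  | S m =>
      RtoC (INR a) * jet z w m (pred a) k b t
      + RtoC (INR k) * jet z w m (pred a) (pred k) b t
      - RtoC (INR b) * z * jet z w m a k (S b) t
  end.

(** Without the logarithm the truncation by [pred] is harmless, since at [a = 0] it comes with the
    factor [INR 0]; the derivative is therefore correct for all [n] and [a]. *)
Definition taylor (z w : C) (n a b : nat) : C := jet z w n a 0 b 0.

Lemma jet_0_0 (z w : C) (a k b : nat) :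
  jet z w 0 a k b 0 = (match k with O => 1 | S _ => 0 end) / (z - w) ^ b.
Proof.
simpl. rewrite Rplus_0_r, ln_1, pow1, Rmult_1_l, Cmult_1_l.
destruct k as [|k]; [easy|]. now rewrite pow_i by lia.
Qed.

Lemma taylor_0 (z w : C) (a b : nat) : taylor z w 0 a b = 1 / (z - w) ^ b.
Proof. apply jet_0_0. Qed.

Lemma taylor_S (z w : C) (n a b : nat) :
  taylor z w (S n) a b
  = RtoC (INR a) * taylor z w n (pred a) b - RtoC (INR b) * z * taylor z w n a (S b).
Proof. unfold taylor. simpl. ring. Qed.

(* Multiplication by [1 + t - 1 = t]. *)
Lemma taylor_shift (z w : C) (n a b : nat) :
  taylor z w (S n) (S a) b = taylor z w (S n) a b + RtoC (INR (S n)) * taylor z w n a b.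
Proof.
revert a b. induction n as [|n IH]; intros a b.
- rewrite !taylor_S, !taylor_0.  rewrite RtoC_INR_S. simpl INR. ring.
(* The factor [INR a] makes this trivial at [a = 0], the one case where the induction hypothesis
   does not apply to [pred a]. *)
- assert (E : RtoC (INR a) * taylor z w (S n) a b
    = RtoC (INR a) * (taylor z w (S n) (pred a) b
                      + RtoC (INR (S n)) * taylor z w n (pred a) b)).
  { destruct a as [|a]; [change (INR 0) with 0%R; ring|].
    simpl pred. now rewrite IH. }
  rewrite taylor_S, (taylor_S _ _ (S n) a), IH, (RtoC_INR_S a), (RtoC_INR_S (S n)).
  simpl pred.
  rewrite !Cmult_plus_distr_r, E.
  assert (E2 := f_equal (Cmult (RtoC (INR (S n)))) (taylor_S z w n a b)).
  rewrite E2. ring.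
Qed.

(* Multiplication by [(1 + t) z - w]. *)
Lemma taylor_denom (z w : C) (n a b : nat) : z - w <> 0 ->
  z * taylor z w n (S a) (S b) - w * taylor z w n a (S b) = taylor z w n a b.
Proof.
intros Hzw. revert a b. induction n as [|n IH]; intros a b.
- rewrite !taylor_0, Cpow_S. field. split; [now apply Cpow_nz | easy].
- assert (E : RtoC (INR a) * (z * taylor z w n a (S b) - w * taylor z w n (pred a) (S b))
    = RtoC (INR a) * taylor z w n (pred a) b).
  { destruct a as [|a]; [change (INR 0) with 0%R; ring|].
    simpl pred. now rewrite IH. }
  rewrite !taylor_S. simpl pred. rewrite <- E, !RtoC_INR_S.
  transitivity (RtoC (INR a)
      * (z * taylor z w n a (S b) - w * taylor z w n (pred a) (S b))
    + z * taylor z w n a (S b) - (RtoC (INR b) + 1) * z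
      * (z * taylor z w n (S a) (S (S b)) - w * taylor z w n a (S (S b)))); [ring|].
  rewrite (IH a (S b)). ring.
Qed.

(** * Residues, their recurrences and initial values *)

(* [residue z w a b M] is the residue at [u = z] of [u ^ M / ((u - z) ^ a (u - w) ^ b)],
   as is seen by substituting [u = z (1 + t)]. *)
Definition residue (z w : C) (a b M : nat) : C :=
  match a with
  | O => 0
  | S n => z ^ M / z ^ n * taylor z w n M b / RtoC (INR (fact n))
  end.

(** Since [u ^ (M + 1) - z u ^ M = u ^ M (u - z)], one factor of the pole at [z] cancels; on Taylor
    coefficients this is [taylor_shift]. *)
Lemma residue_root_z (z w : C) (a b M : nat) : z <> 0 ->
  residue z w (S a) b (S M) - z * residue z w (S a) b M = residue z w a b M.
Proof.
intros Hz. destruct a as [|n]; unfold residue.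
- rewrite !taylor_0, Cpow_S. simpl. unfold Cdiv. ring.
- rewrite taylor_shift, !Cpow_S, RtoC_fact_S, RtoC_INR_S.
  field. rewrite <- RtoC_INR_S.
  repeat split; [| |easy|]; auto using RtoC_fact_neq_0, RtoC_INR_neq_0, Cpow_nz.
Qed.

(** Likewise a factor [u - w] cancels, which is [taylor_denom] after [u = z (1 + t)]. *)
Lemma residue_root_w (z w : C) (a b M : nat) : z <> 0 -> z - w <> 0 ->
  residue z w a (S b) (S M) - w * residue z w a (S b) M = residue z w a b M.
Proof.
intros Hz Hzw. destruct a as [|n]; unfold residue; [ring|].
rewrite <- (taylor_denom z w n M b Hzw), Cpow_S.
field. split; [now apply Cpow_nz|apply RtoC_fact_neq_0].
Qed.

(* By residues, [residue_sum z w (S a) (S b) M] is the coefficient of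
   [t ^ (M - a - b - 1)] in [1 / ((1 - z t) ^ (a + 1) (1 - w t) ^ (b + 1))]. *)
Definition residue_sum (z w : C) (a b M : nat) : C :=
  residue z w a b M + residue w z b a M.

Lemma residue_sum_root_z (z w : C) (a b M : nat) : z <> 0 -> w <> 0 -> z - w <> 0 ->
  residue_sum z w (S a) b (S M) = z * residue_sum z w (S a) b M + residue_sum z w a b M.
Proof.
intros Hz Hw Hzw. unfold residue_sum.
rewrite <- (residue_root_z z w a b M Hz), <- (residue_root_w w z b a M Hw); [ring|].
intros E. apply Hzw. replace (z - w) with (- (w - z)) by ring. rewrite E. ring.
Qed.

Lemma residue_sum_comm (z w : C) (a b M : nat) :
  residue_sum z w a b M = residue_sum w z b a M.
Proof. apply Cplus_comm. Qed.

Lemma residue_sum_root_w (z w : C) (a b M : nat) : z <> 0 -> w <> 0 -> z - w <> 0 ->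
  residue_sum z w a (S b) (S M) = w * residue_sum z w a (S b) M + residue_sum z w a b M.
Proof.
intros Hz Hw Hzw. rewrite !(residue_sum_comm z w). apply residue_sum_root_z; try easy.
intros E. apply Hzw. replace (z - w) with (- (w - z)) by ring. rewrite E. ring.
Qed.

Lemma residue_0_0 (z w : C) (a : nat) : residue z w (S (S a)) 0 0 = 0.
Proof.
unfold residue. rewrite taylor_S. change (INR 0) with 0%R. unfold Cdiv. ring.
Qed.

Lemma residue_0_1 (z w : C) : residue z w 1 0 0 = 1.
Proof. unfold residue. rewrite taylor_0. simpl. field. Qed.

(** The sum of all finite residues is minus the residue at infinity, where the function behaves like
    [u ^ (M - a - b)]. The induction on [M] lowers it through the root recurrences; for [M = 0],
    partial fractions lower [a + b]. *)
Lemma residue_sum_low (z w : C) (a b M : nat) : z <> 0 -> w <> 0 -> z - w <> 0 ->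
  ((M + 1 < a + b)%nat -> residue_sum z w a b M = 0)
  /\ ((M + 1 = a + b)%nat -> residue_sum z w a b M = 1).
Proof.
intros Hz Hw Hzw. revert a b. induction M as [|M IH]; intros a b.
- remember (a + b)%nat as c eqn:Hc. revert a b Hc.
  induction c as [|c IHc]; intros a b Hc; [lia|].
  destruct a as [|a], b as [|b].
  + lia.
  + unfold residue_sum. simpl in Hc. replace b with c by lia.
    split; intros Hc'.
    * destruct c as [|c]; [lia|]. rewrite residue_0_0. simpl. ring.
    * replace c with 0%nat by lia. rewrite residue_0_1. simpl. ring.
  + unfold residue_sum. replace a with c by lia.
    split; intros Hc'.
    * destruct c as [|c]; [lia|]. rewrite residue_0_0. simpl. ring.
    * replace c with 0%nat by lia. rewrite residue_0_1. simpl. ring.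
  + split; intros Hc'; [|lia].
    (* Partial fractions: [z - w = (u - w) - (u - z)]. *)
    assert (E : (z - w) * residue_sum z w (S a) (S b) 0
                = residue_sum z w (S a) b 0 - residue_sum z w a (S b) 0).
    { assert (E1 := residue_sum_root_z z w a (S b) 0 Hz Hw Hzw).
      assert (E2 := residue_sum_root_w z w (S a) b 0 Hz Hw Hzw).
      rewrite E1 in E2.
      transitivity (z * residue_sum z w (S a) (S b) 0 + residue_sum z w a (S b) 0
                    - w * residue_sum z w (S a) (S b) 0 - residue_sum z w a (S b) 0); [ring|].
      rewrite E2. ring. }
    assert (E' : residue_sum z w (S a) b 0 - residue_sum z w a (S b) 0 = 0).
    (* At total order 1 both residue sums are 1, at larger order both are 0; they cancel either
       way. *)
    { destruct (Nat.eq_dec c 1) as [Hc1|Hc1].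
      - rewrite (proj2 (IHc (S a) b ltac:(lia))), (proj2 (IHc a (S b) ltac:(lia)))
          by lia. ring.
      - rewrite (proj1 (IHc (S a) b ltac:(lia))), (proj1 (IHc a (S b) ltac:(lia)))
          by lia. ring. }
    rewrite E' in E.
    replace (residue_sum z w (S a) (S b) 0)
      with (/ (z - w) * ((z - w) * residue_sum z w (S a) (S b) 0))
      by (field; easy).
    rewrite E. ring.
- destruct a as [|a]; [destruct b as [|b]|].
  + lia.
  + rewrite residue_sum_root_w by easy.
    split; intros HM.
    * rewrite !(proj1 (IH _ _)) by lia. ring.
    * rewrite (proj1 (IH 0%nat (S b))), (proj2 (IH 0%nat b)) by lia. ring.
  + rewrite residue_sum_root_z by easy.
    split; intros HM.
    * rewrite !(proj1 (IH _ _)) by lia. ring.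
    * rewrite (proj1 (IH (S a) b)), (proj2 (IH a b)) by lia. ring.
Qed.

(** The factor [(u - z) (u - w) = u ^ 2 - (z + w) u + z w] lowers both pole orders by one. *)
Lemma residue_sum_rec (z w : C) (l M : nat) : z <> 0 -> w <> 0 -> z - w <> 0 ->
  residue_sum z w (S l) (S l) (S (S M))
  = (z + w) * residue_sum z w (S l) (S l) (S M)
    - z * w * residue_sum z w (S l) (S l) M + residue_sum z w l l M.
Proof.
intros Hz Hw Hzw.
assert (E1 := residue_sum_root_z z w l (S l) (S M) Hz Hw Hzw).
assert (E2 := residue_sum_root_w z w l l M Hz Hw Hzw).
assert (E3 := residue_sum_root_z z w l (S l) M Hz Hw Hzw).
rewrite E1, E2.
replace (residue_sum z w l (S l) M)
  with (residue_sum z w (S l) (S l) (S M) - z * residue_sum z w (S l) (S l) M)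
  by (rewrite E3; ring).
ring.
Qed.

(** * Expansion of [(1 + t) ^ m] in powers of [m ln (1 + t)] *)

Lemma sum_n_lincomb (x y : C) (f g h : nat -> C) (K : nat) :
  sum_n (G := C_AbelianMonoid) (fun k => x * f k + g k - y * h k) K
  = x * sum_n (G := C_AbelianMonoid) f K + sum_n (G := C_AbelianMonoid) g K
    - y * sum_n (G := C_AbelianMonoid) h K.
Proof.
induction K as [|K IH].
- now rewrite !sum_O.
- rewrite !sum_Sn, IH. C_eq. ring.
Qed.

(** This differentiates the truncated exponential: [k c ^ k / k! = c c ^ (k - 1) / (k - 1)!], and
    the term [k = 0] vanishes. *)
Lemma sum_n_exp_shift (c : C) (f : nat -> C) (K : nat) :
  sum_n (G := C_AbelianMonoid)
    (fun k => c ^ k / RtoC (INR (fact k)) * (RtoC (INR k) * f (pred k))) (S K)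
  = c * sum_n (G := C_AbelianMonoid)
          (fun k => c ^ k / RtoC (INR (fact k)) * f k) K.
Proof.
induction K as [|K IH].
- rewrite sum_Sn, !sum_O. C_eq. simpl. field.
- rewrite sum_Sn, IH, sum_Sn. C_eq.
  rewrite (RtoC_fact_S (S K)), <- RtoC_INR_S. simpl pred. rewrite (Cpow_S c (S K)).
  field. split; [apply RtoC_fact_neq_0 | now apply RtoC_INR_neq_0].
Qed.

(* The left-hand side is the jet of [(1 + t) ^ a exp (m ln (1 + t))] with the
   exponential series truncated at order [K], which at [t = 0] does not affect
   the first [K] derivatives. *)
Lemma sum_jet (z w : C) (n a b m K : nat) : (n <= K)%nat -> (n <= a)%nat ->
  sum_n (G := C_AbelianMonoid)
    (fun k => RtoC (INR m) ^ k / RtoC (INR (fact k)) * jet z w n a k b 0) K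
  = taylor z w n (a + m) b.
Proof.
revert a b K. induction n as [|n IH]; intros a b K HK Ha.
- rewrite taylor_0. clear HK Ha. induction K as [|K IHK].
  + rewrite sum_O, jet_0_0. simpl.
    replace (1 / 1) with (RtoC 1) by field. apply Cmult_1_l.
  + rewrite sum_Sn, IHK, jet_0_0. C_eq. unfold Cdiv. ring.
- destruct K as [|K]; [lia|]. destruct a as [|a]; [lia|].
  set (c := RtoC (INR m)).
  rewrite (sum_n_ext _ (fun k =>
    RtoC (INR (S a)) * (c ^ k / RtoC (INR (fact k)) * jet z w n a k b 0)
    + c ^ k / RtoC (INR (fact k)) * (RtoC (INR k) * jet z w n a (pred k) b 0)
    - RtoC (INR b) * z
      * (c ^ k / RtoC (INR (fact k)) * jet z w n (S a) k (S b) 0)))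
    by (intros k; cbn [jet pred]; unfold Cdiv; C_eq; ring).
  rewrite sum_n_lincomb.
  (* Differentiating the logarithms yields [m] times the sum truncated at [K]; with the factor [S a]
     from the power this gives the factor [S a + m] of [taylor_S]. *)
  rewrite (sum_n_exp_shift c (fun k => jet z w n a k b 0)).
  unfold c. rewrite !IH by lia.
  rewrite taylor_S.  simpl pred. rewrite plus_INR, RtoC_plus, !RtoC_INR_S.
  C_eq. ring.
Qed.

(** * Differentiation of functions from R to C; jets as iterated derivatives *)

Lemma is_derive_C (f : R -> C) (t : R) (l : C) :
  is_derive (fun x => Re (f x)) t (Re l) ->
  is_derive (fun x => Im (f x)) t (Im l) ->
  is_derive (V := C_R_NormedModule) f t l.
Proof.
intros H1 H2.
apply (is_derive_scal_l (V := C_R_NormedModule) _ _ _ (RtoC 1)) in H1.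
apply (is_derive_scal_l (V := C_R_NormedModule) _ _ _ Ci) in H2.
assert (H3 := is_derive_plus (V := C_R_NormedModule) _ _ _ _ _ H1 H2).
replace l with (plus (scal (V := C_R_NormedModule) (Re l) (RtoC 1))
                     (scal (V := C_R_NormedModule) (Im l) Ci)).
- eapply is_derive_ext; [|exact H3]. intros x. cbv beta.
  rewrite !scal_R_Cmult. C_eq. destruct (f x) as [u v].
  apply injective_projections; simpl; ring.
- rewrite !scal_R_Cmult. C_eq. destruct l as [u v].
  apply injective_projections; simpl; ring.
Qed.

Lemma is_derive_Re (f : R -> C) (t : R) (l : C) :
  is_derive (V := C_R_NormedModule) f t l -> is_derive (fun x => Re (f x)) t (Re l).
Proof.
intros Hf.
apply (filterdiff_ext_lin _ (fun h : R => Re (scal (V := C_R_ModuleSpace) h l))).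
2: intros h; reflexivity.
apply (filterdiff_comp' f (fun c : C_R_NormedModule => Re c)); [exact Hf|].
apply filterdiff_linear, is_linear_fst.
Qed.

Lemma is_derive_Im (f : R -> C) (t : R) (l : C) :
  is_derive (V := C_R_NormedModule) f t l -> is_derive (fun x => Im (f x)) t (Im l).
Proof.
intros Hf.
apply (filterdiff_ext_lin _ (fun h : R => Im (scal (V := C_R_ModuleSpace) h l))).
2: intros h; reflexivity.
apply (filterdiff_comp' f (fun c : C_R_NormedModule => Im c)); [exact Hf|].
apply filterdiff_linear, is_linear_snd.
Qed.

Lemma is_derive_Cmult (f g : R -> C) (t : R) (l m : C) :
  is_derive (V := C_R_NormedModule) f t l ->
  is_derive (V := C_R_NormedModule) g t m ->
  is_derive (V := C_R_NormedModule) (fun x => f x * g x) t (l * g t + f t * m).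
Proof.
intros Hf Hg.
assert (F1 := is_derive_Re _ _ _ Hf). assert (F2 := is_derive_Im _ _ _ Hf).
assert (G1 := is_derive_Re _ _ _ Hg). assert (G2 := is_derive_Im _ _ _ Hg).
assert (P : forall u v a b, is_derive u t a -> is_derive v t b ->
  is_derive (fun x : R => (u x * v x)%R) t (a * v t + u t * b)%R).
{ intros u v a b Hu Hv. apply (is_derive_mult (K := R_AbsRing)); try easy.
  intros; apply Rmult_comm. }
apply is_derive_C.
- assert (D := is_derive_minus _ _ _ _ _ (P _ _ _ _ F1 G1) (P _ _ _ _ F2 G2)).
  match type of D with is_derive _ _ ?d =>
    replace (Re (l * g t + f t * m)) with d; [exact D|] end.
  unfold minus, plus, opp; simpl. unfold Re, Im. ring.
- assert (D := is_derive_plus _ _ _ _ _ (P _ _ _ _ F1 G2) (P _ _ _ _ F2 G1)).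
  match type of D with is_derive _ _ ?d =>
    replace (Im (l * g t + f t * m)) with d; [exact D|] end.
  unfold plus; simpl. unfold Re, Im. ring.
Qed.

Lemma is_derive_Cconst_mult (c : C) (f : R -> C) (t : R) (l : C) :
  is_derive (V := C_R_NormedModule) f t l ->
  is_derive (V := C_R_NormedModule) (fun x => c * f x) t (c * l).
Proof.
intros Hf.
replace (c * l) with (0 * f t + c * l) by ring.
apply (is_derive_Cmult (fun _ => c)); [|exact Hf].
apply (is_derive_const (V := C_R_NormedModule)).
Qed.

Lemma is_derive_RtoC (f : R -> R) (t l : R) :
  is_derive f t l -> is_derive (V := C_R_NormedModule) (fun x => RtoC (f x)) t (RtoC l).
Proof.
intros Hf. apply is_derive_C; [exact Hf|].
apply (is_derive_const (V := R_NormedModule) 0%R t).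
Qed.

Lemma is_derive_Cpow (f : R -> C) (n : nat) (t : R) (l : C) :
  is_derive (V := C_R_NormedModule) f t l ->
  is_derive (V := C_R_NormedModule) (fun x => f x ^ n) t
    (RtoC (INR n) * f t ^ pred n * l).
Proof.
intros Hf. induction n as [|n IH].
- simpl. replace (0 * 1 * l) with (RtoC 0) by ring.
  apply (is_derive_const (V := C_R_NormedModule)).
- replace (RtoC (INR (S n)) * f t ^ pred (S n) * l)
    with (l * f t ^ n + f t * (RtoC (INR n) * f t ^ pred n * l)).
  + apply (is_derive_Cmult f (fun x => f x ^ n)); [exact Hf | exact IH].
  + rewrite RtoC_INR_S. destruct n as [|n]; simpl; [|]; ring.
Qed.

Lemma is_derive_Cinv_linear (z w : C) (t : R) : RtoC (1 + t) * z - w <> 0 ->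
  is_derive (V := C_R_NormedModule) (fun x => / (RtoC (1 + x) * z - w)) t
    (- z * (/ (RtoC (1 + t) * z - w)) ^ 2).
Proof.
intros Hq. destruct z as [z1 z2], w as [w1 w2].
(* The squared modulus of the denominator, by which both components of the inverse divide. *)
assert (Hn : (((1 + t) * z1 - w1) ^ 2 + ((1 + t) * z2 - w2) ^ 2 <> 0)%R).
{ intros E. apply Hq. rewrite <- !Rsqr_pow2 in E.
  destruct (Rplus_sqr_eq_0 _ _ E) as [E1 E2].
  apply injective_projections; simpl;
    [etransitivity; [|exact E1]|etransitivity; [|exact E2]]; ring. }
apply is_derive_C; unfold Cinv; simpl.
- auto_derive.
  + intros E. apply Hn. rewrite <- E. ring.
  + field. intros E. apply Hn. rewrite <- E. ring.
- auto_derive.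
  + intros E. apply Hn. rewrite <- E. ring.
  + field. intros E. apply Hn. rewrite <- E. ring.
Qed.

(** Since [/ 0 = 0], this holds at [c = 0] too, so [jet] can be rewritten at every real argument. *)
Lemma Cpow_inv_total (c : C) (n : nat) : (/ c) ^ n = / c ^ n.
Proof.
destruct (Ceq_dec c 0) as [->|Hc]; [|now apply Cpow_inv].
assert (E : / 0 = 0) by (apply injective_projections; simpl; unfold Rdiv; ring).
destruct n as [|n]; simpl.
- field.
- now rewrite E, !Cmult_0_l, E.
Qed.

(** The recursion of [jet] is the product rule. By [n < a] it never takes [pred] of an exponent 0 of
    [1 + t], where differentiating the logarithm would call for a negative power. *)
Lemma is_derive_jet (z w : C) (n a k b : nat) (t : R) :
  -1 < t -> RtoC (1 + t) * z - w <> 0 -> (n < a)%nat ->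
  is_derive (V := C_R_NormedModule) (jet z w n a k b) t (jet z w (S n) a k b t).
Proof.
intros Ht Hq. revert a k b. induction n as [|n IH]; intros a k b Ha.
- apply (is_derive_ext (V := C_R_NormedModule) (fun x =>
    RtoC ((1 + x) ^ a * ln (1 + x) ^ k) * (/ (RtoC (1 + x) * z - w)) ^ b)).
  { intros x. simpl. now rewrite Cpow_inv_total. }
  assert (D1 : is_derive (fun x => (1 + x) ^ a * ln (1 + x) ^ k)%R t
    (INR a * ((1 + t) ^ pred a * ln (1 + t) ^ k)
     + INR k * ((1 + t) ^ pred a * ln (1 + t) ^ pred k))%R).
  { auto_derive; [lra|]. destruct a as [|a]; [lia|]. simpl pred.
    rewrite <- tech_pow_Rmult. field. lra. }
  assert (D := is_derive_Cmult _ _ _ _ _ (is_derive_RtoC _ _ _ D1)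
    (is_derive_Cpow _ b _ _ (is_derive_Cinv_linear z w t Hq))).
  cbv beta in D.
  match type of D with is_derive _ _ ?d =>
    replace (jet z w 1 a k b t) with d; [exact D|] end.
  cbn [jet]. unfold Cdiv. rewrite !(Cpow_inv _ _ Hq), RtoC_plus, !RtoC_mult.
  destruct b as [|b].
  + simpl. ring.
  + simpl pred. rewrite !Cpow_S. field. split; [now apply Cpow_nz|easy].
- apply (is_derive_ext (V := C_R_NormedModule) (fun x =>
    RtoC (INR a) * jet z w n (pred a) k b x
    + RtoC (INR k) * jet z w n (pred a) (pred k) b x
    - RtoC (INR b) * z * jet z w n a k (S b) x)); [easy|].
  change (jet z w (S (S n)) a k b t) with
    (RtoC (INR a) * jet z w (S n) (pred a) k b t
    + RtoC (INR k) * jet z w (S n) (pred a) (pred k) b t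
    - RtoC (INR b) * z * jet z w (S n) a k (S b) t).
  apply (is_derive_minus (V := C_R_NormedModule));
    [apply (is_derive_plus (V := C_R_NormedModule))|];
    apply is_derive_Cconst_mult, IH; lia.
Qed.

Lemma C_Derive_n_jet (z w : C) (n a k b : nat) (t : R) :
  (forall u, -1 < u -> RtoC (1 + u) * z - w <> 0) -> (n <= a)%nat -> -1 < t ->
  C_Derive_n (jet z w 0 a k b) n t = jet z w n a k b t.
Proof.
intros Hq. revert t. induction n as [|n IH]; intros t Hn Ht; [easy|].
apply C_Derive_unique.
apply (is_derive_ext_loc (V := C_R_NormedModule) (jet z w n a k b)).
(* The ball of radius [t + 1] around [t] stays in [u > -1], where the induction hypothesis
   applies. *)
- assert (He : 0 < t + 1) by lra. exists (mkposreal _ He). intros u Hu.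
  symmetry. apply IH; [lia|].
  unfold ball in Hu; simpl in Hu; unfold AbsRing_ball in Hu.
  unfold abs, minus, plus, opp in Hu; simpl in Hu.
  apply Rabs_lt_between in Hu. lra.
- apply is_derive_jet; auto.
Qed.

(** The powers of [z - w] cancel; the remaining derivative is the borderline case [n = a] of
    [C_Derive_n_jet]. *)
Lemma G_jet (lam k : nat) (z w : C) :
  (forall u, -1 < u -> RtoC (1 + u) * z - w <> 0) ->
  G lam k z w / (z - w) ^ (2 * lam - 1 - k)
  = / RtoC (INR (fact (lam - 1))) * / RtoC (INR (fact k))
    * jet z w (lam - 1) (lam - 1) k lam 0.
Proof.
intros Hq.
assert (Hzw : z - w <> 0).
{ specialize (Hq 0%R ltac:(lra)). now rewrite Rplus_0_r, Cmult_1_l in Hq. }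
unfold G. rewrite <- (C_Derive_n_jet _ _ _ _ _ _ 0 Hq) by (lia || lra).
cbn [jet]. set (D := C_Derive_n _ _ _).
field. repeat split; auto using RtoC_fact_neq_0, Cpow_nz.
Qed.

(** * Recurrence for the Gegenbauer coefficients, and their form as residue sums *)

Lemma CV_radius_gegenbauer (lam : nat) (r : R) :
  Rbar_lt 0 (CV_radius (fun n => gegenbauer lam n r)).
Proof.
destruct (gegenbauer_generating lam r) as [[e He] HL].
apply CV_radius_pos with (e / 2)%R; [lra|].
eexists. apply HL.
unfold ball; simpl; unfold AbsRing_ball, abs, minus, plus, opp; simpl.
rewrite Rabs_pos_eq; lra.
Qed.

(* Multiply the generating function of index [S lam] by [1 - 2 r t + t ^ 2]. *)
Lemma gegenbauer_S (lam n : nat) (r : R) :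
  PS_plus (PS_plus (fun n => gegenbauer (S lam) n r)
             (PS_scal (- 2 * r)%R (PS_incr_1 (fun n => gegenbauer (S lam) n r))))
    (PS_incr_1 (PS_incr_1 (fun n => gegenbauer (S lam) n r))) n
  = gegenbauer lam n r.
Proof.
set (a := fun n => gegenbauer (S lam) n r).
set (b := PS_plus _ _).
assert (Ha := CV_radius_gegenbauer (S lam) r). fold a in Ha.
assert (HD : locally 0%R (fun t : R => 1 - 2 * r * t + t ^ 2 <> 0)%R).
{ assert (HC : continuous (fun t : R => 1 - 2 * r * t + t ^ 2)%R 0%R).
  { apply (ex_derive_continuous (fun t : R => 1 - 2 * r * t + t ^ 2)%R).
    auto_derive. easy. }
  (* At [t = 0] the polynomial is 1, and the ball of radius 1 around 1 misses 0. *)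
  apply (HC (fun y : R => y <> 0%R)). exists (mkposreal 1 Rlt_0_1). intros y Hy ->.
  unfold ball in Hy; simpl in Hy; unfold AbsRing_ball in Hy.
  unfold abs, minus, plus, opp in Hy; simpl in Hy.
  apply Rabs_lt_between in Hy. lra. }
assert (HL : locally 0%R (fun t => is_pseries b t (/ (1 - 2 * r * t + t ^ 2) ^ lam)%R)).
{ generalize (filter_and _ _ HD (gegenbauer_generating (S lam) r)). fold a.
  apply filter_imp. intros t [Ht Et].
  assert (E := is_pseries_plus _ _ _ _ _ (is_pseries_plus _ _ _ _ _ Et
     (is_pseries_scal (- 2 * r)%R _ _ _ (Rmult_comm _ _) (is_pseries_incr_1 _ _ _ Et)))
     (is_pseries_incr_1 _ _ _ (is_pseries_incr_1 _ _ _ Et))).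
  match type of E with is_pseries _ _ ?l =>
    replace (/ (1 - 2 * r * t + t ^ 2) ^ lam)%R with l; [exact E|] end.
  transitivity ((1 - 2 * r * t + t ^ 2) * / (1 - 2 * r * t + t ^ 2) ^ S lam)%R.
  - generalize (/ (1 - 2 * r * t + t ^ 2) ^ S lam)%R. intros y.
    unfold scal, plus; simpl; unfold mult; simpl.
    R_eq. ring.
  - revert Ht.
    generalize (1 - 2 * r * t + t ^ 2)%R. intros q Hq.
    R_eq. simpl. field. split; [now apply pow_nonzero | exact Hq]. }
apply (PSeries_ext_recip b (fun n => gegenbauer lam n r)).
- destruct HL as [[e He] HL].
  apply CV_radius_pos with (e / 2)%R; [lra|].
  eexists. apply HL.
  unfold ball; simpl; unfold AbsRing_ball, abs, minus, plus, opp; simpl.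
  rewrite Rabs_pos_eq; lra.
- apply CV_radius_gegenbauer.
- generalize (filter_and _ _ HL (gegenbauer_generating lam r)).
  apply filter_imp. intros t [E1 E2].
  apply is_pseries_unique in E1, E2. unfold PSeries in *. now rewrite E1, E2.
Qed.

Lemma gegenbauer_S_0 (lam : nat) (r : R) :
  gegenbauer (S lam) 0 r = gegenbauer lam 0 r.
Proof.
rewrite <- (gegenbauer_S lam 0 r).
unfold PS_plus, PS_scal, PS_incr_1, plus, scal, zero; simpl.
unfold mult; simpl. R_eq. ring.
Qed.

Lemma gegenbauer_S_1 (lam : nat) (r : R) :
  gegenbauer (S lam) 1 r = (2 * r * gegenbauer (S lam) 0 r + gegenbauer lam 1 r)%R.
Proof.
rewrite <- (gegenbauer_S lam 1 r).
unfold PS_plus, PS_scal, PS_incr_1, plus, scal, zero; simpl.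
unfold mult; simpl. R_eq. ring.
Qed.

Lemma gegenbauer_S_SS (lam n : nat) (r : R) :
  gegenbauer (S lam) (S (S n)) r
  = (2 * r * gegenbauer (S lam) (S n) r - gegenbauer (S lam) n r
     + gegenbauer lam (S (S n)) r)%R.
Proof.
rewrite <- (gegenbauer_S lam (S (S n)) r).
unfold PS_plus, PS_scal, PS_incr_1, plus, scal, zero; simpl.
unfold mult; simpl. R_eq. ring.
Qed.

Lemma gegenbauer_0_0 (r : R) : gegenbauer 0 0 r = 1%R.
Proof. unfold gegenbauer. simpl. field. Qed.

Lemma gegenbauer_0_S (n : nat) (r : R) : gegenbauer 0 (S n) r = 0%R.
Proof.
unfold gegenbauer.
rewrite (Derive_n_ext _ (fun _ => 1%R)) by (intros t; simpl; field).
rewrite Derive_n_const. unfold Rdiv. ring.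
Qed.

(** The hypotheses say [1 - 2 r (rho t) + (rho t) ^ 2 = (1 - z t) (1 - w t)], so [gegenbauer_S_SS]
    scaled by [rho ^ n] becomes [residue_sum_rec]. The outer induction supplies the inhomogeneous
    term of index one less, the inner one carries two consecutive [n]. *)
Lemma gegenbauer_residue_sum (z w : C) (r rho : R) (l n : nat) :
  z <> 0 -> w <> 0 -> z - w <> 0 ->
  RtoC (2 * r * rho) = z + w -> RtoC (rho ^ 2) = z * w ->
  RtoC (gegenbauer (S l) n r * rho ^ n) = residue_sum z w (S l) (S l) (S (n + l + l)).
Proof.
intros Hz Hw Hzw Hsum Hprod.
revert n. induction l as [|l IHl].
(* Index 1 cannot be reduced to index 0: [gegenbauer 0 0 r] is 1, whereas [residue_sum z w 0 0] is
   always 0. *)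
- enough (P : forall n,
    RtoC (gegenbauer 1 n r * rho ^ n) = residue_sum z w 1 1 (S n)
    /\ RtoC (gegenbauer 1 (S n) r * rho ^ S n) = residue_sum z w 1 1 (S (S n))).
  { intros n. rewrite !Nat.add_0_r. apply P. }
  induction n as [|n [IH1 IH2]].
  + split.
    * rewrite gegenbauer_S_0, gegenbauer_0_0.
      rewrite (proj2 (residue_sum_low z w 1 1 1 Hz Hw Hzw)) by easy.
      simpl. now rewrite Rmult_1_r.
    * rewrite gegenbauer_S_1, gegenbauer_S_0, gegenbauer_0_0, gegenbauer_0_S.
      rewrite residue_sum_rec by easy.
      rewrite (proj2 (residue_sum_low z w 1 1 1 Hz Hw Hzw)) by easy.
      rewrite (proj1 (residue_sum_low z w 1 1 0 Hz Hw Hzw)) by lia.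
      rewrite <- Hsum.
      replace ((2 * r * 1 + 0) * rho ^ 1)%R with (2 * r * rho)%R by (simpl; ring).
      unfold residue_sum; simpl. ring.
  + split; [exact IH2|].
    rewrite residue_sum_rec by easy. rewrite <- IH1, <- IH2, <- Hsum, <- Hprod.
    rewrite gegenbauer_S_SS, gegenbauer_0_S.
    unfold residue_sum; simpl residue. rewrite <- !RtoC_mult, <- RtoC_minus.
    rewrite !Cplus_0_r. f_equal. simpl. ring.
- enough (P : forall n,
    RtoC (gegenbauer (S (S l)) n r * rho ^ n)
    = residue_sum z w (S (S l)) (S (S l)) (S (n + S l + S l))
    /\ RtoC (gegenbauer (S (S l)) (S n) r * rho ^ S n)
       = residue_sum z w (S (S l)) (S (S l)) (S (S n + S l + S l))).
  { apply P. }
  assert (H1 : residue_sum z w (S (S l)) (S (S l)) (S (S l + S l)) = 1).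
  { apply (residue_sum_low z w _ _ _ Hz Hw Hzw). lia. }
  assert (G0 : forall k, gegenbauer k 0 r = 1%R).
  { induction k as [|k IHk]; [apply gegenbauer_0_0|]. now rewrite gegenbauer_S_0. }
  induction n as [|n [IH1 IH2]].
  + split.
    * change (0 + S l + S l)%nat with (S l + S l)%nat. rewrite H1, G0.
      simpl. now rewrite Rmult_1_r.
    * replace (S (1 + S l + S l)) with (S (S (S l + S l))) by lia.
      rewrite residue_sum_rec by easy. rewrite H1.
      rewrite (proj1 (residue_sum_low z w _ _ _ Hz Hw Hzw)) by lia.
      replace (S l + S l)%nat with (S (1 + l + l)) by lia.
      rewrite <- IHl, <- Hsum.
      rewrite gegenbauer_S_1, G0.
      replace ((2 * r * 1 + gegenbauer (S l) 1 r) * rho ^ 1)%R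
        with (2 * r * rho + gegenbauer (S l) 1 r * rho ^ 1)%R by (simpl; ring).
      rewrite RtoC_plus. ring.
  + split; [exact IH2|].
    replace (S (S (S n) + S l + S l)) with (S (S (S (n + S l + S l)))) by lia.
    rewrite residue_sum_rec by easy.
    replace (S (S (n + S l + S l))) with (S (S n + S l + S l)) by lia.
    rewrite <- IH1, <- IH2, <- Hsum, <- Hprod.
    replace (S (n + S l + S l)) with (S (S (S n) + l + l)) by lia.
    rewrite <- IHl, gegenbauer_S_SS.
    rewrite <- !RtoC_mult, <- RtoC_minus, <- RtoC_plus. f_equal. simpl. ring.
Qed.

(** * Polylogarithm series and their sum over [k] *)

(** Applying [t d/dt] turns the coefficients [n ^ k] into [n ^ (k + 1)] and keeps the radius. *)
Lemma CV_radius_pow (k : nat) : Rbar_le 1 (CV_radius (fun n => INR n ^ k)%R).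
Proof.
induction k as [|k IH].
- apply (CV_radius_bounded (fun n => INR n ^ 0)%R). exists 1%R. intros n.
  rewrite pow1. simpl. rewrite Rmult_1_r, Rabs_R1. lra.
- rewrite (CV_radius_ext _ (PS_incr_1 (PS_derive (fun n => INR n ^ k)%R))).
  + now rewrite CV_radius_incr_1, CV_radius_derive.
  + intros [|n]; [simpl; unfold zero; simpl; ring|].
    unfold PS_incr_1, PS_derive. now rewrite <- tech_pow_Rmult.
Qed.

(** Bounding [1 / m ^ s] by 1 leaves the majorant [m ^ k |z| ^ m], which converges by
    [CV_radius_pow]. *)
Lemma is_series_Li (s k : nat) (z : C) : Cmod z < 1 ->
  is_series (V := C_R_NormedModule)
    (fun n => z ^ S n * RtoC (INR (S n)) ^ k / RtoC (INR (S n)) ^ s)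
    (Li (Z.of_nat s - Z.of_nat k) z).
Proof.
intros Hz.
set (a := fun n => z ^ S n / RtoC (powerRZ (INR (S n)) (Z.of_nat s - Z.of_nat k))).
assert (Ea : forall n,
  a n = z ^ S n * RtoC (INR (S n)) ^ k / RtoC (INR (S n)) ^ s).
{ intros n. unfold a.
  assert (Hn : INR (S n) <> 0%R) by now apply not_0_INR.
  unfold Z.sub. rewrite powerRZ_add, powerRZ_neg', <- !pow_powerRZ by easy.
  rewrite RtoC_mult, RtoC_inv, !RtoC_pow by now apply pow_nonzero.
  field. split; apply Cpow_nz, RtoC_INR_neq_0; easy. }
assert (Hex : C_ex_series a).
{ apply (ex_series_le (V := C_R_CompleteNormedModule) a
    (fun n => Rabs (INR (S n) ^ k * Cmod z ^ S n))).
  - intros n. rewrite <- Cmod_norm.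
    assert (Hn : 1 <= INR (S n)) by (rewrite S_INR; pose proof (pos_INR n); lra).
    assert (Hs : 1 <= INR (S n) ^ s) by now apply pow_R1_Rle.
    assert (Hk : 0 <= INR (S n) ^ k) by (apply pow_le; lra).
    assert (Hq : 0 <= Cmod z ^ S n) by apply pow_le, Cmod_ge_0.
    rewrite Ea, Cmod_div by (apply Cpow_nz, RtoC_INR_neq_0; easy).
    rewrite Cmod_mult, !Cmod_pow, Cmod_R, (Rabs_pos_eq (INR (S n))) by lra.
    rewrite Rabs_pos_eq by now apply Rmult_le_pos.
    rewrite (Rmult_comm (Cmod z ^ S n)).
    rewrite <- (Rdiv_1_r (INR (S n) ^ k * Cmod z ^ S n)) at 2.
    apply Rmult_le_compat_l; [now apply Rmult_le_pos|].
    apply Rinv_le_contravar; lra.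
  - apply (ex_series_incr_1 (fun n => Rabs (INR n ^ k * Cmod z ^ n))).
    apply (CV_disk_inside (fun n => INR n ^ k)%R).
    eapply Rbar_lt_le_trans; [|apply CV_radius_pow].
    simpl. rewrite Rabs_pos_eq by apply Cmod_ge_0. exact Hz. }
destruct Hex as [l Hl].
apply (is_series_ext a); [exact Ea|].
unfold Li. fold a. now rewrite (C_Series_unique a l Hl).
Qed.

Lemma is_series_sum_n (f : nat -> nat -> C) (l : nat -> C) (K : nat) :
  (forall k, is_series (V := C_R_NormedModule) (f k) (l k)) ->
  is_series (V := C_R_NormedModule)
    (fun n => sum_n (G := C_AbelianMonoid) (fun k => f k n) K)
    (sum_n (G := C_AbelianMonoid) l K).
Proof.
intros Hf. induction K as [|K IH].
- rewrite sum_O. apply (is_series_ext (f 0%nat)); [|apply Hf].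
  intros n. now rewrite sum_O.
- rewrite sum_Sn.
  eapply is_series_ext; [|exact (is_series_plus _ _ _ _ IH (Hf (S K)))].
  intros n. symmetry. apply (sum_Sn (fun k => f k n)).
Qed.

Lemma is_series_Cmult_l (c : C) (a : nat -> C) (l : C) :
  is_series (V := C_R_NormedModule) a l ->
  is_series (V := C_R_NormedModule) (fun n => c * a n) (c * l).
Proof.
intros Ha. exact (is_series_scal (K := C_AbsRing) (V := C_NormedModule) c a l Ha).
Qed.

Lemma is_series_drop_zeros (a : nat -> C) (N : nat) (l : C) :
  (forall n, (n < N)%nat -> a n = 0) ->
  is_series (V := C_R_NormedModule) a l ->
  is_series (V := C_R_NormedModule) (fun n => a (N + n)%nat) l.
Proof.
revert a. induction N as [|N IH]; intros a Ha0 Ha; [exact Ha|].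
apply (IH (fun n => a (S n))).
- intros n Hn. apply Ha0. lia.
- apply (is_series_incr_1 (V := C_R_NormedModule) a).
  rewrite Ha0 by lia. change (is_series (V := C_R_NormedModule) a (l + 0)).
  now rewrite Cplus_0_r.
Qed.

(** For [m = n + 1], [sum_jet] collects the [k]-sum of the terms of order [m] into a Taylor
    coefficient with exponent [l + m], and [z ^ m = z ^ (l + m) / z ^ l] completes the residue. *)
Lemma is_series_Li_sum (l s : nat) (z w : C) :
  (forall u, -1 < u -> RtoC (1 + u) * z - w <> 0) -> z <> 0 -> Cmod z < 1 ->
  is_series (V := C_R_NormedModule)
    (fun n => residue z w (S l) (S l) (l + S n) / RtoC (INR (S n)) ^ s)
    (Li_sum (S l) s z w).
Proof.
intros Hq Hz0 Hz.
eapply is_series_ext; [|apply is_series_sum_n; intros k;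
  apply is_series_Cmult_l, is_series_Li, Hz].
intros n. cbv beta.
set (c := RtoC (INR (S n))).
set (x := / RtoC (INR (fact l)) * z ^ S n / c ^ s).
transitivity (x * sum_n (G := C_AbelianMonoid)
  (fun k => c ^ k / RtoC (INR (fact k)) * jet z w l l k (S l) 0) l).
- etransitivity;
    [|exact (sum_n_mult_l (K := C_Ring) x
       (fun k => c ^ k / RtoC (INR (fact k)) * jet z w l l k (S l) 0) l)].
  replace (S l - 1)%nat with l by lia.
  apply (sum_n_ext (G := C_AbelianMonoid)). intros k.
  rewrite G_jet by exact Hq. replace (S l - 1)%nat with l by lia.
  change mult with Cmult. C_eq. unfold x, Cdiv. ring.
- unfold c. rewrite sum_jet by lia. unfold x, residue, c. rewrite Cpow_add_r.
  C_eq. field. repeat split; auto using RtoC_fact_neq_0, Cpow_nz, RtoC_INR_neq_0.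
Qed.

(** * Specialization to conjugate arguments and conclusion *)

(** The imaginary part is [(2 + u) Im z]. *)
Lemma Cconj_sub_neq_0 (z : C) (u : R) : z <> Cconj z -> -1 < u ->
  RtoC (1 + u) * z - Cconj z <> 0.
Proof.
intros Hz Hu E. apply Hz. destruct z as [x y].
apply (f_equal Im) in E. simpl in E.
assert (Hy : y = 0%R) by nra. subst y.
apply injective_projections; simpl; ring.
Qed.

(** This is [gegenbauer_residue_sum] with [rho] the modulus of [z], whose square is
    [z * Cconj z]. *)
Lemma Sigma_term_residue_sum (l s n : nat) (z : C) : z <> Cconj z -> z <> 0 ->
  Sigma_term (S l) s z n
  = residue_sum z (Cconj z) (S l) (S l) (S (n + l + l)) / RtoC (INR (S l + n)) ^ s.
Proof.
intros Hz Hz0. unfold Sigma_term.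
assert (Hc : Cconj z <> 0) by (intros Ec; apply Hz0; rewrite <- (Cconj_conj z), Ec;
  apply injective_projections; simpl; ring).
assert (Hd : z - Cconj z <> 0) by now apply Cminus_eq_contra.
assert (E : Re (z * Cconj z) = (Cmod z ^ 2)%R).
{ rewrite <- Cmod2_conj. apply re_RtoC. }
assert (Hp : 0 < Cmod z) by now apply Cmod_gt_0.
rewrite E, <- Rsqr_pow2, sqrt_Rsqr by lra.
rewrite <- (gegenbauer_residue_sum z (Cconj z)
  (Re (z + Cconj z) / (2 * Cmod z)) (Cmod z)); try easy.
- rewrite Rsqr_pow2. replace (Rpower (Cmod z ^ 2) (INR n / 2)) with (Cmod z ^ n)%R.
  + unfold Rdiv at 2. rewrite Rmult_1_l, <- RtoC_pow, RtoC_mult, RtoC_inv; [easy|].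
    apply pow_nonzero. rewrite plus_INR, S_INR.
    pose proof (pos_INR l). pose proof (pos_INR n). lra.
  + rewrite <- Rpower_pow by easy. rewrite <- (Rpower_pow 2) by easy.
    rewrite Rpower_mult. f_equal. simpl. field.
- replace (2 * (Re (z + Cconj z) / (2 * Cmod z)) * Cmod z)%R
    with (Re (z + Cconj z)) by (field; now apply Rgt_not_eq).
  apply injective_projections; simpl; ring.
- apply Cmod2_conj.
Qed.

Theorem proposition7 (lam s : nat) (z : C)
  (hlam : (1 <= lam)%nat) (hz1 : Cmod z < 1) (hz2 : z <> Cconj z) :
  C_ex_series (Sigma_term lam s z) /\
  Sigma lam s z = (Li_sum lam s z (Cconj z) + Li_sum lam s (Cconj z) z)%C.
Proof.
destruct lam as [|l]; [lia|].
enough (HS : is_series (V := C_R_NormedModule) (Sigma_term (S l) s z)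
  (Li_sum (S l) s z (Cconj z) + Li_sum (S l) s (Cconj z) z)%C).
{ split; [eexists; exact HS | now apply C_Series_unique]. }
assert (Hcc : Cconj (Cconj z) = z) by apply Cconj_conj.
assert (hz3 : Cconj z <> Cconj (Cconj z)) by (rewrite Hcc; congruence).
assert (Hz : z <> 0).
{ intros ->. apply hz2. apply injective_projections; simpl; ring. }
assert (Hw : Cconj z <> 0).
{ intros E. apply Hz. rewrite <- Hcc, E. apply injective_projections; simpl; ring. }
assert (S1 := is_series_Li_sum l s z (Cconj z)
  (fun u => Cconj_sub_neq_0 z u hz2) Hz hz1).
assert (S2 : is_series (V := C_R_NormedModule)
    (fun n => residue (Cconj z) z (S l) (S l) (l + S n) / RtoC (INR (S n)) ^ s)%C
    (Li_sum (S l) s (Cconj z) z)).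
{ apply is_series_Li_sum; [|exact Hw|now rewrite Cmod_conj].
  intros u Hu. rewrite <- Hcc at 2. now apply Cconj_sub_neq_0. }
assert (S3 := is_series_plus _ _ _ _ S1 S2).
(* The polylogarithms start at [m = 1], [Sigma] at [m = S l]; the [l] terms in between are residue
   sums that vanish by [residue_sum_low]. *)
apply (is_series_drop_zeros _ l) in S3.
- eapply is_series_ext; [|exact S3]. intros n. rewrite Sigma_term_residue_sum by easy.
  replace (l + S (l + n))%nat with (S (n + l + l)) by lia.
  change plus with Cplus. unfold residue_sum, Cdiv. C_eq. simpl Nat.add. ring.
- intros n Hn.
  transitivity (residue_sum z (Cconj z) (S l) (S l) (l + S n) / RtoC (INR (S n)) ^ s)%C.
  + change plus with Cplus. unfold residue_sum, Cdiv. ring.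
  + rewrite (proj1 (residue_sum_low z (Cconj z) (S l) (S l) (l + S n) Hz Hw
      (Cminus_eq_contra _ _ hz2))) by lia. unfold Cdiv. ring.
Qed.
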